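(* Let $X=(X^x)_{x\in\mathbb{R}}$ be a one-dimensional deterministic Feller process (which is a deterministic Hunt process) of type $\oplus$ or $\ominus$, with generating path $\Phi$. Then $X$ is rich if and only if $\Phi$ is continuously differentiable.
   Context: A deterministic Markov process on $\mathbb{R}$ is a family $(X^x)_{x\in\mathbb{R}}$ of functions $t\mapsto X_t^x\in\mathbb{R}$, $t\in[0,\infty)$, with $X_0^x=x$ and such that $X_s^x=X_t^y$ implies $X_{s+h}^x=X_{t+h}^y$ for every $h\ge 0$. It is a Hunt process if all paths are continuous (equivalently, càdlàg and quasi-left continuous). A deterministic Hunt process is of type $\oplus$ (resp. $\ominus$) if there are an interval $I$ containing $0$ and a continuous, surjective, strictly increasing (resp. strictly decreasing) function $\Phi:I\to\mathbb{R}$, the generating path, such that $X_t^x=\Phi(t+\Phi^{-1}(x))$ for all $x\in\mathbb{R}$ and $t\ge0$ (in particular the right endpoint of $I$ is $\infty$, as there is no killing). The semigroup is $T_tu(x)=u(X_t^x)$. With $C_\infty(\mathbb{R})$ the continuous functions vanishing at infinity, $X$ is Feller if $T_t:C_\infty(\mathbb{R})\to C_\infty(\mathbb{R})$ for all $t\ge0$ and $\lim_{t\downarrow0}\|T_tu-u\|_\infty=0$ for all $u\in C_\infty(\mathbb{R})$. The generator is $Au=\lim_{t\downarrow0}(T_tu-u)/t$ with domain $D(A)$ the set of bounded Borel functions $u$ for which this limit exists in $\|\cdot\|_\infty$. $X$ is rich if $C_c^\infty(\mathbb{R})\subseteq D(A)$ and $A(C_c^\infty(\mathbb{R}))\subseteq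 C_\infty(\mathbb{R})$. *)

(* Defs.v *)
From HB Require Import structures.
From mathcomp Require Import all_boot all_order all_algebra.
From mathcomp Require Import all_classical all_reals all_analysis.

Set Implicit Arguments.
Unset Strict Implicit.
Unset Printing Implicit Defensive.
Import Order.TTheory GRing.Theory Num.Theory.
Import numFieldNormedType.Exports.

Local Open Scope classical_set_scope.
Local Open Scope ring_scope.

(* [X x t] is the position at time [t] of the path started at [x]; only its
   values for [0 <= t] are ever used. *)
Definition deterministic_markov (R : realType) (X : R -> R -> R) : Prop :=
  (forall x, X x 0 = x) /\
  (forall x y s t, 0 <= s -> 0 <= t -> X x s = X y t ->
     forall h, 0 <= h -> X x (s + h) = X y (t + h)).

Definition deterministic_hunt (R : realType) (X : R -> R -> R) : Prop :=
  deterministic_markov X /\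
  (forall x, {within [set t : R | 0 <= t], continuous (X x)}).

(* A function on an interval [J] is represented by a total function of which
   only the values on [J] matter.  The membership [t + _ \in J] says that the
   formula for [X x t] is meaningful: [J] is unbounded on the right. *)
Definition generated_by (R : realType) (X : R -> R -> R)
    (J : interval R) (Phi : R -> R) : Prop :=
  [/\ 0 \in J,
      {within [set` J], continuous Phi},
      set_surj [set` J] [set: R] Phi &
      forall x t, 0 <= t ->
        t + 'pinv_(fun=> 0) [set` J] Phi x \in J /\
        X x t = Phi (t + 'pinv_(fun=> 0) [set` J] Phi x)].

Definition type_oplus (R : realType) (X : R -> R -> R)
    (J : interval R) (Phi : R -> R) : Prop :=
  {in J &, forall s t, s < t -> Phi s < Phi t} /\ generated_by X J Phi.

Definition type_ominus (R : realType) (X : R -> R -> R)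
    (J : interval R) (Phi : R -> R) : Prop :=
  {in J &, forall s t, s < t -> Phi t < Phi s} /\ generated_by X J Phi.

Definition semigroup (R : realType) (X : R -> R -> R) (t : R) (u : R -> R) :
    R -> R :=
  fun x => u (X x t).

Definition sup_norm (R : realType) (u : R -> R) : \bar R :=
  ereal_sup [set (`|u x|)%:E | x in [set: R]].

Definition C_infty (R : realType) : set (R -> R) :=
  [set u : R -> R | [/\ continuous u, u x @[x --> +oo] --> (0 : R)
             & u x @[x --> -oo] --> (0 : R)]].

Definition bounded_borel (R : realType) : set (R -> R) :=
  [set u : R -> R | measurable_fun [set: R] u /\ [bounded u x | x in [set: R]]].

Definition Cc_smooth (R : realType) : set (R -> R) :=
  [set u : R -> R | (forall (n : nat) (x : R), derivable (derive1n n u) x 1) /\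
           compact (closure [set x | u x != 0])].

Definition feller (R : realType) (X : R -> R -> R) : Prop :=
  (forall t u, 0 <= t -> C_infty u -> C_infty (semigroup X t u)) /\
  (forall u, C_infty u ->
     sup_norm (fun x => semigroup X t u x - u x) @[t --> 0^'+] --> 0%E).

(* The graph of the generator: [generator X u v] means that [u] is in its
   domain and is mapped to [v]. *)
Definition generator (R : realType) (X : R -> R -> R) (u v : R -> R) : Prop :=
  [/\ bounded_borel u, bounded_borel v &
      sup_norm (fun x => (semigroup X t u x - u x) / t - v x) @[t --> 0^'+]
        --> 0%E].

Definition generator_domain (R : realType) (X : R -> R -> R) : set (R -> R) :=
  [set u : R -> R | exists v, generator X u v].

Definition rich (R : realType) (X : R -> R -> R) : Prop :=
  @Cc_smooth R `<=` generator_domain X /\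
  (forall u v, Cc_smooth u -> generator X u v -> C_infty v).

(* Two-sided derivatives are the right ones on an interval carrying a
   generating path: strict monotonicity and surjectivity onto the real line
   force such an interval to be open. *)
Definition continuously_differentiable (R : realType)
    (J : interval R) (Phi : R -> R) : Prop :=
  (forall t, t \in J -> derivable Phi t 1) /\
  {within [set` J], continuous (derive1 Phi)}.

(* Main.v *)
Require Import Defs.
From mathcomp Require Import all_boot all_order all_algebra.
From mathcomp Require Import all_classical all_reals all_analysis.
From mathcomp Require Import ring lra.

(* Only two properties of [Phi] matter: it is a homeomorphism of the open
   interval [J] onto the line, and [X] moves [Phi s] to [Phi (t + s)].  So the
   difference quotients of the semigroup at [u] are those of [u \o Phi], and [u]
   is in the domain of the generator when they converge uniformly on [J].  If
   [Phi] is C^1, uniformity follows from the mean value theorem and compactness.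
   Conversely, the uniform limit of right difference quotients yields a
   continuous two-sided derivative of [u \o Phi], and near a given point [Phi]
   is recovered from [u \o Phi] by taking a test function [u] with nonzero
   derivative there.  Such a [u] is a translate of
   exp (-1 / x) exp (-1 / (1 - x)) on ]0, 1[. *)

Set Implicit Arguments.
Unset Strict Implicit.
Unset Printing Implicit Defensive.
Import Order.TTheory GRing.Theory Num.Theory.
Import numFieldNormedType.Exports.

Local Open Scope classical_set_scope.
Local Open Scope ring_scope.

(** * Functions that are flat at 0 *)

Section flat_functions.
Context {R : realType}.

(** The case [k = 0] is the classical smooth, non-analytic exp (-1 / x). The powers [x ^- k]
    produced by differentiating it are built in, so that derivatives are again linear combinations
    of such functions. *)
Definition flat (k : nat) (x : R) : R :=
  if 0 < x then x ^- k * expR (- x^-1) else 0.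

Lemma flat_npos k x : x <= 0 -> flat k x = 0.
Proof. by rewrite /flat ltNge => ->. Qed.

Lemma flat_gt0 k x : 0 < x -> 0 < flat k x.
Proof.
by move=> x0; rewrite /flat x0 mulr_gt0 ?expR_gt0// invr_gt0 exprn_gt0.
Qed.

(* With the bound [flat_le], this gives both continuity and
   differentiability at 0. *)
Lemma flat_mulS k x : flat k x = flat k.+1 x * x.
Proof.
rewrite /flat; case: ifPn => x0; last by rewrite mul0r.
by rewrite exprSr; field; rewrite expf_neq0 gt_eqF.
Qed.

(** For [y = x^-1 > 0], the number [y ^+ k / k!] is one term of the exponential series of
    nonnegative terms, hence at most exp y. *)
Lemma flat_le k x : `|flat k x| <= k`!%:R.
Proof.
have [x0|x0] := leP x 0; first by rewrite flat_npos// normr0.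
rewrite gtr0_norm ?flat_gt0// /flat x0 expRN ler_pdivrMr ?expR_gt0// -exprVn.
have y0 : 0 <= x^-1 by rewrite invr_ge0 ltW.
case: k => [|k].
  by rewrite expr0 fact0 mul1r (le_trans _ (expR_ge1Dx _))// lerDl.
rewrite mulrC -ler_pdivrMr ?ltr0n ?fact_gt0//.
by apply: le_trans (expR_ge1Dxn k y0); rewrite lerDr.
Qed.

Lemma continuous_flat0 k : {for 0, continuous (flat k)}.
Proof.
apply/cvgrPdist_le => e e0; near=> x.
rewrite (flat_npos k (lexx 0)) sub0r normrN flat_mulS normrM.
apply: (@le_trans _ _ (k.+1`!%:R * (e / k.+1`!%:R))).
  apply: ler_pM => //; first exact: flat_le.
  near: x; exists (e / k.+1`!%:R) => /=.
    by rewrite divr_gt0// ltr0n fact_gt0.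
  by move=> y /=; rewrite sub0r normrN => /ltW.
by rewrite mulrC divfK// pnatr_eq0 -lt0n fact_gt0.
Unshelve. all: by end_near. Qed.

Lemma is_derive_flat k (x : R) :
  is_derive x 1 (flat k) (flat k.+2 x - k%:R * flat k.+1 x).
Proof.
have [x0|x0|->] := ltgtP x 0.
- rewrite !(flat_npos _ (ltW x0)) mulr0 subr0.
  apply: (@near_eq_is_derive _ _ _ (cst 0)).
  near=> y; rewrite flat_npos//; apply: ltW; near: y; exact: lt_nbhsl.
- apply: (@near_eq_is_derive _ _ _
    ((fun x => (x ^+ k)^-1) * (fun x => expR (- x^-1)))).
    near=> y; rewrite /flat ifT//; near: y; exact: lt_nbhsr.
  have xn0 : x != 0 by rewrite gt_eqF.
  have xk0 : x ^+ k != 0 by rewrite expf_neq0.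
  have dX : is_derive x 1 (fun y => (y ^+ k)^-1)
      (- (x ^+ k) ^- 2 * (k%:R * x ^+ k.-1)).
    apply: is_deriveV => //; apply: DeriveDef; first exact: exprn_derivable.
    by rewrite exp_derive /GRing.scale /= mulr1.
  have dE : is_derive x 1 (expR \o (fun y => - y^-1))
      (expR (- x^-1) * - (- x ^- 2 * 1)).
    apply: is_derive1_comp; apply: is_deriveN.
    by apply: (is_deriveV xn0); exact: is_derive_id.
  apply: (is_derive_eq (is_deriveM dX dE)).
  rewrite /flat x0 /GRing.scale /=.
  case: k {dX} xk0 => [|k] xk0 /=; first by rewrite !expr0; field.
  by rewrite !exprS; field; rewrite xn0 expf_neq0.
(* By [flat_mulS] the slope of [flat k] from 0 is [flat k.+1], which is continuous at 0 with value
   0. *)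
- apply/is_derive1_caratheodory; exists (flat k.+1); split.
  + by move=> z; rewrite (flat_npos _ (lexx 0)) !subr0 flat_mulS.
  + exact: continuous_flat0.
  + by rewrite !flat_npos// mulr0 subr0.
Unshelve. all: by end_near. Qed.

End flat_functions.

(** * Smooth bumps supported in [[a, a + 1]] *)

Section test_functions.
Context {R : realType}.

(* Closed under differentiation, hence made of smooth functions. *)
Inductive bumps (a : R) : (R -> R) -> Prop :=
| bumps_prod i j : bumps a (fun x => flat i (x - a) * flat j (a + 1 - x))
| bumps_scale k f : bumps a f -> bumps a (fun x => k * f x)
| bumps_add f g : bumps a f -> bumps a g -> bumps a (fun x => f x + g x).

Lemma is_derive_subr (a x : R) : is_derive x 1 (fun y : R => y - a) 1.
Proof. by apply: is_derive_eq; rewrite subr0. Qed.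

Lemma is_derive_subl (a x : R) : is_derive x 1 (fun y : R => a - y) (-1).
Proof. by apply: is_derive_eq; rewrite add0r mul1r. Qed.

Lemma bumps_is_derive a f : bumps a f ->
  exists2 g, bumps a g & forall x : R, is_derive x 1 f (g x).
Proof.
elim=> [i j|k {}f _ [g bg df]|{}f g _ [f' bf' df] _ [g' bg' dg]].
- pose F m n x := flat m (x - a) * flat n (a + 1 - x).
  exists (fun x => (F i.+2 j x + (- i%:R) * F i.+1 j x) +
                   ((- 1) * F i j.+2 x + j%:R * F i j.+1 x)).
    by do ?[exact: bumps_prod | apply: bumps_add | apply: bumps_scale].
  move=> x.
  have dl : is_derive x 1 (fun x => flat i (x - a))
      ((flat i.+2 (x - a) - i%:R * flat i.+1 (x - a)) * 1).
    exact: is_derive1_comp (is_derive_flat _ _) (is_derive_subr _ _).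
  have dr : is_derive x 1 (fun x => flat j (a + 1 - x))
      ((flat j.+2 (a + 1 - x) - j%:R * flat j.+1 (a + 1 - x)) * (-1)).
    exact: is_derive1_comp (is_derive_flat _ _) (is_derive_subl _ _).
  apply: (is_derive_eq (is_deriveM dl dr)).
  by rewrite /GRing.scale /= /F; ring.
- exists (fun x => k * g x); first exact: bumps_scale.
  by move=> x; apply: is_deriveZ.
- exists (fun x => f' x + g' x); first exact: bumps_add.
  by move=> x; apply: is_deriveD.
Qed.

Lemma bumps_smooth a f n : bumps a f ->
  bumps a (derive1n n f) /\ (forall x : R, derivable (derive1n n f) x 1).
Proof.
move=> bf; have bn : bumps a (derive1n n f).
  elim: n => [//|n /bumps_is_derive[g bg dg]].
  rewrite /derive1n iterS -/(derive1n n f).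
  suff -> : derive1 (derive1n n f) = g by [].
  by apply/funext => x; rewrite derive1E; exact: derive_val.
by split=> // x; have [g _ dg] := bumps_is_derive bn; exact: ex_derive.
Qed.

Lemma bumps_out a f x : bumps a f -> x \notin `[a, a + 1] -> f x = 0.
Proof.
move=> bf; rewrite in_itv /= negb_and -!ltNge => xa.
elim: bf => [i j|k {}f _ ->|{}f g _ -> _ ->]; rewrite ?mulr0 ?addr0//.
case/orP: xa => xa; first by rewrite flat_npos ?mul0r// subr_le0 ltW.
by rewrite (flat_npos j) ?mulr0// subr_le0 ltW.
Qed.

Lemma bumps_Cc_smooth a f : bumps a f -> Cc_smooth f.
Proof.
move=> bf; split=> [n|]; first exact: (bumps_smooth n bf).2.
apply: (subclosed_compact _ (@segment_compact _ a (a + 1))).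
  exact: closed_closure.
rewrite (closure_id `[a, a + 1]).1; last exact: itv_closed.
apply: closure_subset => x /=.
by apply: contraNT => /(bumps_out bf) ->.
Qed.

(** The bump on [[0, 1]] is 0 at 0 and positive at 1/2, so by the mean value theorem its derivative
    is nonzero at some [c]; translation by [x - c] carries [c] to [x]. *)
Lemma exists_test_function (x : R) :
  exists2 u : R -> R, Cc_smooth u & derive1 u x != 0.
Proof.
pose b a (y : R) := flat 0 (y - a) * flat 0 (a + 1 - y).
have bb a : bumps a (b a) by exact: bumps_prod.
have [g bg db] := bumps_is_derive (bb 0).
have [c _ bc] : exists2 c, c \in `[0, 2^-1 : R] &
    b 0 2^-1 - b 0 0 = g c * (2^-1 - 0).
  apply: MVT_segment; first by rewrite invr_ge0.
  apply: derivable_within_continuous => y _; exact: ex_derive.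
have gc0 : g c != 0.
  apply/eqP => gc; move: bc; rewrite gc mul0r {2}/b subr0.
  rewrite (flat_npos _ (lexx 0)) mul0r subr0 => /eqP; apply/negP.
  by rewrite gt_eqF// mulr_gt0// flat_gt0//; lra.
exists (b (x - c)); first exact: bumps_Cc_smooth (bb _).
suff : is_derive x 1 (b (x - c)) (g c * 1).
  by move=> d; rewrite derive1E derive_val mulr1.
have -> : b (x - c) = b 0 \o (fun y => y - (x - c)).
  by apply/funext => y; rewrite /b /=; congr (flat _ _ * flat _ _); ring.
apply: is_derive1_comp; last exact: is_derive_subr.
by rewrite opprB addrC subrK.
Qed.

End test_functions.

(** * Generating paths as homeomorphisms onto the line *)

Section line_parametrization.
Context {R : realType}.
Implicit Types (J : interval R) (Phi P : R -> R).

(* What the two types of generating path have in common: [Phi] is a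
   homeomorphism of the open interval [J] onto the line, with inverse [P]. *)
Definition line_param J Phi P : Prop :=
  [/\ (forall x, P x \in J) /\ cancel P Phi, {in J, cancel Phi P},
      continuous P,
      (forall t, t \in J -> exists c d, [/\ c \in J, d \in J, c < t & t < d]) &
      forall A, exists c d,
        [/\ c \in J, d \in J & forall t, t \in J -> `|Phi t| <= A -> c <= t <= d]].

Lemma interval_convex J c d t :
  c \in J -> d \in J -> c <= t <= d -> t \in J.
Proof. by move=> cJ dJ; exact: (@interval_is_interval R J c d cJ dJ). Qed.

Lemma line_param_near J Phi P t : line_param J Phi P -> t \in J ->
  \forall s \near t, s \in J.
Proof.
move=> [_ _ _ Jopen _] /Jopen[c [d [cJ dJ ct td]]].
near=> s; apply: (interval_convex cJ dJ); apply/andP; split; apply: ltW; near: s.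
  exact: lt_nbhsr.
exact: lt_nbhsl.
Unshelve. all: by end_near. Qed.

Lemma line_param_within J Phi P (f : R -> R) : line_param J Phi P ->
  {within [set` J], continuous f} <-> {in J, continuous f}.
Proof.
move=> Jp; have Jo : open [set` J].
  rewrite openE => t /= tJ; exact: line_param_near Jp tJ.
rewrite continuous_open_subspace//; split=> cf t tJ; apply: cf; first exact: mem_set.
by move: tJ; rewrite inE.
Qed.

(** [Phi] is an order isomorphism from [J] to the line, so order facts transfer: [P (Phi t - 1)] and
    [P (Phi t + 1)] surround [t] in [J], and [P (- A)], [P A] enclose the preimage of [[- A, A]]. *)
Lemma increasing_line_param J Phi P :
  {in J &, {homo Phi : s t / s < t}} ->
  (forall x, P x \in J) -> cancel P Phi -> line_param J Phi P.
Proof.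
move=> Pinc PJ PK.
have mono := leW_mono_in (le_mono_in Pinc).
have lemono := le_mono_in Pinc.
have inj := inc_inj_in lemono.
have PhiK : {in J, cancel Phi P} by move=> t tJ; apply: inj; rewrite ?PK.
have Jopen t : t \in J -> exists c d, [/\ c \in J, d \in J, c < t & t < d].
  move=> tJ; exists (P (Phi t - 1)), (P (Phi t + 1)).
  by split; rewrite // -mono// PK; [rewrite ltrBlDr|]; rewrite ltrDl.
split=> //.
- move=> x; apply/cvgrPdist_le => e e0.
  have [c [d [cJ dJ cx xd]]] := Jopen _ (PJ x).
  pose c1 := Num.max c (P x - e); pose d1 := Num.min d (P x + e).
  have c1x : c1 < P x by rewrite gt_max cx ltrBlDr ltrDl.
  have xd1 : P x < d1 by rewrite lt_min xd ltrDl.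
  have c1J : c1 \in J.
    by apply: (interval_convex cJ (PJ x)); rewrite (ltW c1x) le_max lexx.
  have d1J : d1 \in J.
    by apply: (interval_convex (PJ x) dJ); rewrite (ltW xd1) ge_min lexx.
  have lx : Phi c1 < x by rewrite -[ltRHS]PK mono.
  have xr : x < Phi d1 by rewrite -[ltLHS]PK mono.
  near=> y.
  have /andP[] : c1 < P y < d1.
    rewrite -mono// -(mono _ d1)// PK; apply/andP; split; near: y.
      exact: lt_nbhsr.
    exact: lt_nbhsl.
  rewrite gt_max lt_min => /andP[_ yl] /andP[_ yr].
  by rewrite ler_norml; apply/andP; split; lra.
- move=> A; exists (P (- A)), (P A); split=> // t tJ.
  by rewrite ler_norml => /andP[Al Ar]; rewrite -lemono// PK Al -lemono// PK.
Unshelve. all: by end_near. Qed.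

(** Reduces a decreasing path to the increasing path [- Phi]. *)
Lemma line_param_opp J Phi P :
  line_param J (fun t => - Phi t) (fun x => P (- x)) -> line_param J Phi P.
Proof.
move=> [[PJ PK] PhiK Pc Jopen bnd]; split=> //.
- by split=> x; [rewrite -[x]opprK|rewrite -[LHS]opprK -{1}[x]opprK PK opprK].
- by move=> t tJ; rewrite -[in LHS](opprK (Phi t)) PhiK.
- have -> : P = (fun x => P (- x)) \o -%R by apply/funext => x /=; rewrite opprK.
  by move=> x; apply: continuous_comp; [exact: opp_continuous|exact: Pc].
- move=> A; have [c [d [cJ dJ cd]]] := bnd A.
  by exists c, d; split=> // t tJ; rewrite -normrN; exact: cd.
Qed.

Lemma generating_path_line_param (X : R -> R -> R) J Phi :
  type_oplus X J Phi \/ type_ominus X J Phi ->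
  exists P, [/\ line_param J Phi P, {in J, continuous Phi} &
    forall x t, 0 <= t -> t + P x \in J /\ X x t = Phi (t + P x)].
Proof.
move=> tX; suff [P JP [cPhi XE]] : exists2 P, line_param J Phi P &
    {within [set` J], continuous Phi} /\
    forall x t, 0 <= t -> t + P x \in J /\ X x t = Phi (t + P x).
  by exists P; split=> //; exact/(line_param_within _ JP).
case: tX => -[Pm [_ cPhi Psurj Xt]]; exists ('pinv_(fun=> 0) [set` J] Phi) => //.
- apply: increasing_line_param => //.
    (* At time 0 the membership in [generated_by] says that the pseudo-inverse takes its values in
       [J]. *)
    by move=> x; have [] := Xt x 0 (lexx 0); rewrite add0r.
  by move=> x; rewrite (surjpK _ Psurj)// inE.
- apply: line_param_opp; apply: increasing_line_param => //.
  + by move=> s t sJ tJ st; rewrite ltrN2 Pm.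
  + by move=> x; have [] := Xt (- x) 0 (lexx 0); rewrite add0r.
  + by move=> x; rewrite (surjpK _ Psurj) ?opprK// inE.
Qed.

End line_parametrization.

(** * Uniform convergence and uniqueness of the generator's image *)

Section sup_norm.
Context {R : realType}.

Lemma sup_norm_le (u : R -> R) (e : R) :
  (sup_norm u <= e%:E)%E <-> forall x, `|u x| <= e.
Proof.
split=> [ue x|ue].
  by rewrite -lee_fin (le_trans _ ue)//; apply: ereal_sup_ubound; exists x.
by apply: ge_ereal_sup => _ [x _ <-]; rewrite lee_fin.
Qed.

Lemma sup_norm_ge0 (u : R -> R) : (0 <= sup_norm u)%E.
Proof.
apply: (@le_trans _ _ (`|u 0|%:E)); first by rewrite lee_fin.
by apply: ereal_sup_ubound; exists 0.
Qed.

Lemma sup_norm_cvg0 {T : Type} (F : set_system T) {FF : Filter F}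
    (f : T -> R -> R) :
  sup_norm (f t) @[t --> F] --> 0%E <->
  forall e, 0 < e -> \forall t \near F, forall x, `|f t x| <= e.
Proof.
split=> [/fine_cvgP[ffin /cvgr0Pnorm_le fcvg] e e0|fe].
  near=> t; apply/sup_norm_le.
  rewrite -[leLHS]fineK; last by near: t.
  by rewrite lee_fin (le_trans (ler_norm _))//; near: t; exact: fcvg.
have finE t (e : R) : (forall x, `|f t x| <= e) -> sup_norm (f t) \is a fin_num.
  move=> /sup_norm_le fte; rewrite ge0_fin_numE ?sup_norm_ge0//.
  exact: le_lt_trans fte (ltry _).
(* The norm may be infinite; the bound with [e = 1] makes it eventually finite. *)
apply/fine_cvgP; split; first by apply: filterS (fe 1 ltr01) => t; exact: finE.
apply/cvgr0Pnorm_le => e e0; apply: filterS (fe e e0) => t fte /=.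
rewrite ger0_norm ?fine_ge0 ?sup_norm_ge0//.
by rewrite -lee_fin fineK ?(finE _ _ fte)//; exact/sup_norm_le.
Unshelve. all: by end_near. Qed.

(** Since [rich] speaks of every image of [u], this makes it enough to exhibit one image in
    [C_infty]. *)
Lemma generator_unique (X : R -> R -> R) (u v w : R -> R) :
  generator X u v -> generator X u w -> v = w.
Proof.
move=> [_ _ /sup_norm_cvg0 uv] [_ _ /sup_norm_cvg0 uw].
apply/funext => x; apply/eqP; rewrite -subr_eq0 -normr_le0.
apply/ler_addgt0Pl => e e0; rewrite addr0.
near (0 : R)^'+ => t.
have tv : `|(semigroup X t u x - u x) / t - v x| <= e / 2.
  by near: t; apply: filterS (uv _ _) => [t|]; [exact|rewrite divr_gt0].
have tw : `|(semigroup X t u x - u x) / t - w x| <= e / 2.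
  by near: t; apply: filterS (uw _ _) => [t|]; [exact|rewrite divr_gt0].
move: tv tw; set q := _ / t; move=> tv tw.
rewrite (_ : v x - w x = (q - w x) - (q - v x)); last by ring.
by rewrite (le_trans (ler_normB _ _))// [leRHS]splitr lerD.
Unshelve. all: by end_near. Qed.

End sup_norm.

(** * Compactly supported functions *)

Section compact_support.
Context {R : realType}.

Lemma Cc_smooth_support (u : R -> R) : Cc_smooth u ->
  exists A, forall x, A < `|x| -> u x = 0.
Proof.
move=> [_ /compact_bounded[M [_ Mu]]]; exists (M + 1) => x.
apply: contraTeq => ux; rewrite -leNgt; apply: Mu; first by rewrite ltrDl.
exact: subset_closure.
Qed.

Lemma Cc_smooth_is_derive (u : R -> R) (x : R) :
  Cc_smooth u -> is_derive x 1 u (derive1 u x).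
Proof. by move=> [du _]; rewrite derive1E; apply: derivableP; exact: (du 0). Qed.

Lemma is_derive_continuous (f : R -> R) (x a : R) :
  is_derive x 1 f a -> {for x, continuous f}.
Proof. by move=> [df _]; exact/differentiable_continuous/derivable1_diffP. Qed.

Lemma Cc_smooth_continuous (u : R -> R) : Cc_smooth u -> continuous u.
Proof. by move=> cu x; exact: is_derive_continuous (Cc_smooth_is_derive x cu). Qed.

Lemma Cc_smooth_derive1 (u : R -> R) : Cc_smooth u -> continuous (derive1 u).
Proof.
move=> [du _] x; apply/differentiable_continuous/derivable1_diffP; exact: (du 1).
Qed.

Lemma derive1_out (u : R -> R) (A : R) : (forall x, A < `|x| -> u x = 0) ->
  forall x, A < `|x| -> derive1 u x = 0.
Proof.
move=> uA x Ax; rewrite derive1E (@near_eq_derive _ _ _ _ (cst 0)) ?derive_cst//.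
have Ay : \forall y \near x, A < `|y|.
  have := @norm_continuous _ R x; move/cvgr_gt; exact.
by apply: filterS Ay => y; exact: uA.
Qed.

Lemma compact_support_C_infty (f : R -> R) (A : R) : continuous f ->
  (forall x, A < `|x| -> f x = 0) -> C_infty f.
Proof.
move=> cf fA; split=> //; apply: cvg_near_cst; near=> x; apply: fA.
  rewrite (lt_le_trans _ (ler_norm _))//.
  by near: x; apply: nbhs_pinfty_gt; exact: num_real.
rewrite -normrN (lt_le_trans _ (ler_norm _))// ltrNr.
by near: x; apply: nbhs_ninfty_lt; exact: num_real.
Unshelve. all: by end_near. Qed.

Lemma compact_support_bounded_borel (f : R -> R) (A : R) : continuous f ->
  (forall x, A < `|x| -> f x = 0) -> bounded_borel f.
Proof.
move=> cf fA; split; first exact: measurable_realfun.continuous_measurable_fun.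
have : compact (f @` `[- A, A]).
  apply: continuous_compact; last exact: segment_compact.
  exact: continuous_subspaceT.
(* The maximum with 0 covers the points outside [[- A, A]], where [f] is 0. *)
move=> /compact_bounded[M [Mreal MA]]; exists (Num.max M 0); split.
  by rewrite realE le_max lexx orbT.
move=> B; rewrite gt_max => /andP[MB B0] x _ /=.
have [xA|Ax] := leP `|x| A; last by rewrite fA// normr0 ltW.
by apply: (MA B MB); exists x => //=; rewrite in_itv /= -ler_norml.
Qed.

End compact_support.

(** * Difference quotients *)

Section derivatives.
Context {R : realType}.

(* If [u' (Phi t) <> 0] then [u] has a local difference quotient through which
   the increments of [Phi] can be recovered from those of [u \o Phi]. *)
Lemma is_derive_factor (u Phi : R -> R) (t a b : R) :
  {for t, continuous Phi} -> is_derive t 1 (u \o Phi) a ->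
  is_derive (Phi t) 1 u b -> b != 0 -> is_derive t 1 Phi (a / b).
Proof.
move=> cPhi /is_derive1_caratheodory[r [rE cr <-]].
move=> /is_derive1_caratheodory[q [qE cq <-]] q0.
(* Where [q (Phi s)] vanishes, the plain quotient is a default that keeps the slope identity true
   for all [s]; near [t] it is never taken. *)
pose k s := if q (Phi s) != 0 then r s / q (Phi s) else (Phi s - Phi t) / (s - t).
have cqPhi : {for t, continuous (q \o Phi)} by apply: continuous_comp.
have kt : k t = r t / q (Phi t) by rewrite /k q0.
apply/is_derive1_caratheodory; exists k; split=> //.
- move=> s; rewrite /k; case: ifPn => [qs0|].
    by rewrite mulrAC -rE /= qE mulrC mulKf.
  rewrite negbK => qs0; rewrite divfK// subr_eq0.
  by apply: contra_neq q0 => <-; exact/eqP.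
- have cc : (r s / q (Phi s)) @[s --> t] --> r t / q (Phi t).
    by apply: cvgM => //; apply: cvgV.
  suff : k s @[s --> t] --> k t by [].
  rewrite kt; apply: cvg_trans cc; apply: near_eq_cvg.
  have qn0 : \forall s \near t, q (Phi s) != 0 by exact: cvgr_neq0 cqPhi q0.
  by near=> s; rewrite /k (near qn0 s).
Unshelve. all: by end_near.
Qed.

(** The quotient is [g' y] for some [y] between [s] and [h + s], and both [g' y] and [g' s] are
    within [e / 2] of [g' t]. The joint neighbourhood in [s] and [h] is what a compactness argument
    can make uniform in [s]. *)
Lemma near_difference_quotient (g g' : R -> R) (t e : R) : 0 < e ->
  (\forall s \near t, is_derive (s : R) 1 g (g' s)) -> {for t, continuous g'} ->
  \forall s \near t & h \near 0^'+, `|(g (h + s) - g s) / h - g' s| <= e.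
Proof.
move=> e0 dg cg'.
have e20 : 0 < e / 2 by rewrite divr_gt0.
have : \forall s \near t, is_derive (s : R) 1 g (g' s) /\ `|g' t - g' s| <= e / 2.
  by apply: filterI => //; move/cvgrPdist_le : cg'; exact.
move=> /nbhs_ballP[d /= d0 td].
(* Half of [d] is for the distance from [s] to [t], half for the step [h]. *)
have d20 : 0 < d / 2 by rewrite divr_gt0.
have dQ s : t - d < s < t + d -> is_derive s 1 g (g' s) /\ `|g' t - g' s| <= e / 2.
  by move=> sd; apply: td; rewrite /ball /= ltr_norml; lra.
near=> s h.
have /andP[s1 s2] : t - d / 2 < s < t + d / 2.
  apply/andP; split; near: s.
    by apply: lt_nbhsr; rewrite ltrBlDr ltrDl.
  by apply: lt_nbhsl; rewrite ltrDl.
have h0 : 0 < h by near: h; exact: nbhs_right_gt.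
have hd : h < d / 2 by near: h; exact: nbhs_right_lt.
have dg' y : s <= y <= h + s -> is_derive y 1 g (g' y).
  by move=> sy; apply: (dQ y _).1; lra.
have [|y||y] := @MVT_segment _ g g' s (h + s).
- by rewrite lerDr ltW.
- by rewrite in_itv /= => /andP[y1 y2]; apply: dg'; rewrite !ltW.
- apply: derivable_within_continuous => z; rewrite in_itv /= => /dg' dz.
  exact: ex_derive.
rewrite in_itv /= => sy ->; rewrite addrK mulfK ?gt_eqF//.
have [_ ty] : is_derive y 1 g (g' y) /\ `|g' t - g' y| <= e / 2 by apply: dQ; lra.
have [_ ts] : is_derive s 1 g (g' s) /\ `|g' t - g' s| <= e / 2 by apply: dQ; lra.
rewrite (_ : g' y - g' s = (g' t - g' s) - (g' t - g' y)); last by ring.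
by rewrite (le_trans (ler_normB _ _))// [leRHS]splitr lerD.
Unshelve. all: by end_near. Qed.

End derivatives.

(** * Richness against continuous differentiability of the path *)

Section generating_path.
Context {R : realType}.
Variables (X : R -> R -> R) (J : interval R) (Phi P : R -> R).
Hypotheses (JP : line_param J Phi P) (cPhi : {in J, continuous Phi})
  (XE : forall x t, 0 <= t -> t + P x \in J /\ X x t = Phi (t + P x)).

Lemma path_shift t s : 0 <= t -> s \in J -> t + s \in J /\ X (Phi s) t = Phi (t + s).
Proof. by case: JP => _ PhiK _ _ _ t0 sJ; have := XE (Phi s) t0; rewrite PhiK. Qed.

(* The left difference quotient at [t] with step [k] is the right one at
   [t - k], so uniformity in the starting point yields two-sided derivatives. *)
Lemma generator_is_derive u v t : generator X u v -> continuous v ->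
  t \in J -> is_derive t 1 (u \o Phi) (v (Phi t)).
Proof.
move=> [_ _ /sup_norm_cvg0 uv] cv tJ.
have quot e : 0 < e -> \forall h \near 0^'+, forall s, s \in J ->
    `|((u \o Phi) (h + s) - (u \o Phi) s) / h - v (Phi s)| <= e.
  move=> e0; near=> h => s sJ /=.
  have h0 : 0 <= h by near: h; exact: nbhs_right_ge.
  rewrite -(path_shift h0 sJ).2.
  by move: (Phi s); near: h; exact: uv.
pose q (h : R) : R := ((u \o Phi) (h + t) - (u \o Phi) t) / h.
suff dq : q h @[h --> 0^'] --> v (Phi t).
  have qE : (fun h : R => h^-1 *: (((u \o Phi) \o shift t) (h *: 1) - (u \o Phi) t)) = q.
    by apply/funext => h; rewrite /q /= [h *: 1]mulr1 [_ *: _]mulrC.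
  apply: DeriveDef; last by rewrite /derive qE; exact: cvg_lim.
  by rewrite /derivable qE; apply/cvg_ex; exists (v (Phi t)).
apply: (@cvg_at_right_left_dnbhs _ R^o).
- apply/cvgrPdist_le => e e0; have nq := quot _ e0.
  by near=> h; rewrite distrC; exact: (near nq h).
- apply/cvg_at_leftNP; rewrite oppr0; apply/cvgrPdist_le => e e0.
  have e20 : 0 < e / 2 by rewrite divr_gt0.
  have tN : (t - h) @[h --> 0^'+] --> t.
    rewrite -[X in _ --> X]subr0; apply: cvgB; first exact: cvg_cst.
    exact: cvg_at_right_filter.
  have nJ : \forall h \near 0^'+, t - h \in J.
    exact: tN (line_param_near JP tJ).
  have nv : \forall h \near 0^'+, `|v (Phi t) - v (Phi (t - h))| <= e / 2.
    have cvPhi : {for t, continuous (v \o Phi)}.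
      by apply: continuous_comp; [exact: cPhi|exact: cv].
    by move/cvgrPdist_le : cvPhi => /(_ _ e20); exact: tN.
  have nq := quot _ e20.
  near=> h.
  have h0 : 0 < h by near: h; exact: nbhs_right_gt.
  have hJ : t - h \in J by exact: (near nJ h).
  have hv : `|v (Phi t) - v (Phi (t - h))| <= e / 2 by exact: (near nv h).
  have : `|((u \o Phi) (h + (t - h)) - (u \o Phi) (t - h)) / h - v (Phi (t - h))|
      <= e / 2 by apply: (near nq h).
  rewrite /q /= subrKC [- h + t]addrC invrN mulrN -mulNr opprB => hq.
  rewrite (_ : _ - _ = (v (Phi t) - v (Phi (t - h))) -
    ((u (Phi t) - u (Phi (t - h))) / h - v (Phi (t - h)))); last by ring.
  by rewrite (le_trans (ler_normB _ _))// [leRHS]splitr lerD.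
Unshelve. all: by end_near. Qed.

Lemma rich_derivable : rich X -> continuously_differentiable J Phi.
Proof.
move=> [dom img].
(* One pair [u], [v] chosen for [t] serves all [s] with [derive1 u (Phi s)] nonzero, hence a whole
   neighbourhood of [t]; there the derivative of [Phi] is a quotient of continuous functions. *)
have dPhi t : t \in J -> exists u v : R -> R,
    [/\ Cc_smooth u, continuous v, derive1 u (Phi t) != 0 &
    forall s, s \in J -> derive1 u (Phi s) != 0 ->
      is_derive s 1 Phi (v (Phi s) / derive1 u (Phi s))].
  move=> tJ; have [u cu ut] := exists_test_function (Phi t).
  have [v uv] := dom u cu; have [cv _ _] := img u v cu uv.
  exists u, v; split=> // s sJ us0.
  apply: is_derive_factor us0; first exact: cPhi.
    exact: generator_is_derive uv cv sJ.
  exact: Cc_smooth_is_derive.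
split=> [t tJ|].
  by have [u [v [_ _ ut du]]] := dPhi t tJ; have := du t tJ ut => dt; exact: ex_derive.
apply/(line_param_within _ JP) => t tJ.
have [u [v [cu cv ut du]]] := dPhi t tJ.
have cu' := Cc_smooth_derive1 cu.
have cPhit := cPhi tJ.
have cu'Phi : {for t, continuous (derive1 u \o Phi)}.
  by apply: continuous_comp => //; exact: cu'.
have cc : (v (Phi s) / derive1 u (Phi s)) @[s --> t] -->
    v (Phi t) / derive1 u (Phi t).
  apply: cvgM; first by apply: continuous_comp => //; exact: cv.
  exact: cvgV ut cu'Phi.
have un0 : \forall s \near t, derive1 u (Phi s) != 0.
  exact: cvgr_neq0 cu'Phi ut.
suff : derive1 Phi s @[s --> t] --> derive1 Phi t by [].
have dE s : s \in J -> derive1 u (Phi s) != 0 ->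
    derive1 Phi s = v (Phi s) / derive1 u (Phi s).
  by move=> sJ us; have := du s sJ us => ds; rewrite derive1E derive_val.
rewrite dE//; apply: cvg_trans cc; apply: near_eq_cvg.
have nJ := line_param_near JP tJ.
near=> s; rewrite dE//; [exact: (near nJ s)|exact: (near un0 s)].
Unshelve. all: by end_near. Qed.

Lemma derivable_generator u : continuously_differentiable J Phi ->
  Cc_smooth u ->
  exists v, generator X u v /\ C_infty v.
Proof.
move=> [dPhi cdPhi] cu.
have cdP : {in J, continuous (derive1 Phi)} by apply/(line_param_within _ JP).
have [[PJ PK] PhiK cP Jopen bnd] := JP.
have [A uA] := Cc_smooth_support cu.
have u'A := derive1_out uA.
have cu' := Cc_smooth_derive1 cu.
(* By the chain rule, [v (Phi s)] is the derivative of [u \o Phi] at [s]. *)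
pose v x := derive1 u x * derive1 Phi (P x).
have cv : continuous v.
  move=> x; apply: cvgM; first exact: cu'.
  by apply: continuous_comp; [exact: cP|exact: cdP (PJ x)].
have vA x : A < `|x| -> v x = 0 by move=> Ax; rewrite /v u'A// mul0r.
exists v; split; last exact: compact_support_C_infty vA.
split; [|exact: compact_support_bounded_borel vA|].
  exact: compact_support_bounded_borel (Cc_smooth_continuous cu) uA.
have [c [d [cJ dJ cd]]] := bnd A.
(* A path started left of [c] can enter the support of [u] within time [h]; the margin from [c'] to
   [c] absorbs this once [h < c - c']. *)
have [c' [_ [c'J _ c'c _]]] := Jopen _ cJ.
pose g := u \o Phi; pose g' s := v (Phi s).
have dg s : s \in J -> is_derive s 1 g (g' s).
  move=> sJ; rewrite /g' /v PhiK//; apply: is_derive1_comp.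
    exact: Cc_smooth_is_derive.
  by rewrite derive1E; apply: derivableP; exact: dPhi.
have cg' s : s \in J -> {for s, continuous g'}.
  move=> sJ; apply: continuous_comp; last exact: cv.
  exact: cPhi.
apply/sup_norm_cvg0 => e e0.
have Kq : \forall h \near 0^'+, `[c', d] `<=`
    (fun s => `|(g (h + s) - g s) / h - g' s| <= e).
  apply: (compact_near_coveringP _).1; first exact: segment_compact.
  move=> s; rewrite /= in_itv /= => scd.
  have sJ := interval_convex c'J dJ scd.
  apply: near_difference_quotient => //; last exact: cg'.
  by apply: filterS (line_param_near JP sJ) => y; exact: dg.
near=> h => x.
have h0 : 0 < h by near: h; exact: nbhs_right_gt.
have hc : h < c - c' by near: h; apply: nbhs_right_lt; rewrite subr_gt0.
rewrite /semigroup -(PK x); have := PJ x; set s := P x => sJ.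
have [hsJ ->] := path_shift (ltW h0) sJ.
have out y : y \in J -> ~~ (c <= y <= d) -> A < `|Phi y|.
  by move=> yJ; apply: contraNT; rewrite -leNgt; exact: cd.
have [scd|] := boolP (c' <= s <= d).
  have Kh : `[c', d] `<=` (fun s => `|(g (h + s) - g s) / h - g' s| <= e).
    by near: h; exact: Kq.
  by apply: Kh; rewrite /= in_itv.
(* For [s] outside [[c', d]], both [s] and [h + s] lie outside [[c, d]], so the quotient and
   [v (Phi s)] are both 0. *)
move=> ns; have gs : A < `|Phi s|.
  by apply: out => //; apply: contra ns => /andP[cs ->]; rewrite andbT; lra.
have gh : A < `|Phi (h + s)|.
  apply: out => //; apply: contra ns => /andP[chs hsd].
  by apply/andP; split; lra.
by rewrite !uA// vA// !subr0 mul0r normr0 ltW.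
Unshelve. all: by end_near. Qed.

End generating_path.

Theorem proposition3p8 (R : realType) (X : R -> R -> R)
    (J : interval R) (Phi : R -> R)
    (hunt_X : deterministic_hunt X) (feller_X : feller X)
    (type_X : type_oplus X J Phi \/ type_ominus X J Phi) :
  rich X <-> continuously_differentiable J Phi.
Proof.
have [P [JP cPhi XE]] := generating_path_line_param type_X.
split=> [|C1]; first exact: rich_derivable JP cPhi XE.
split=> [u /(derivable_generator JP cPhi XE C1)[v [uv _]]|u v cu uv]; first by exists v.
have [w [uw Cw]] := derivable_generator JP cPhi XE C1 cu.
by rewrite (generator_unique uv uw).
Qed.
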